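(* Let $G$ be an amenable group generated by a finite set $\Sigma$, and let $\sigma$ be an inner automorphism of $G$ of order two, say $\sigma(x)=gxg^{-1}$. Let $\pi_i:G\to G_i$ ($i\in\mathbb N$) be an infinite family of surjective homomorphisms onto finite groups $G_i$ with pairwise distinct kernels, and let $\sigma_i$ be the automorphism of $G_i$ given by conjugation by $\pi_i(g)$. Then the family of twisted Cayley graphs $\{C(G_i,\pi_i(\Sigma\cup\sigma(\Sigma^{-1})))^{\sigma_i}\}_i$ is a non-expander family, i.e. the nontrivial spectra of the normalized adjacency operators of these graphs are not uniformly bounded away from $1$.
   Context: For a finite group $K$, a multiset $T$ of elements of $K$ and an automorphism $\tau$ of $K$, the twisted Cayley graph $C(K,T)^\tau$ has vertex set $K$ and an edge from $x$ to $\tau(xt)$ for each $t\in T$; it is $|T|$-regular and its normalized adjacency operator is its adjacency operator divided by $|T|$. The nontrivial spectrum is the multiset of eigenvalues with one copy of $1$ removed. ''Not uniformly bounded away from $1$'' means there is no $c>0$ such that for every $i$ all nontrivial eigenvalues of the $i$-th normalized adjacency operator have real part at most $1-c$. *)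

(* Defs.v *)
From HB Require Import structures.
From mathcomp Require Import all_boot all_order all_algebra all_fingroup all_field.
From mathcomp Require Import reals.
Set Implicit Arguments. Unset Strict Implicit. Unset Printing Implicit Defensive.
Import Order.TTheory GRing.Theory Num.Theory.

Record grp := Grp {
  gcar :> eqType;
  gmul : gcar -> gcar -> gcar;
  gone : gcar;
  ginv : gcar -> gcar;
  gmulA : forall x y z, gmul x (gmul y z) = gmul (gmul x y) z;
  gmul1 : forall x, gmul gone x = x;
  gmulr1 : forall x, gmul x gone = x;
  gmulV : forall x, gmul (ginv x) x = gone }.

Inductive generated (G : grp) (S : seq G) : G -> Prop :=
  | gen_one : generated S (gone G)
  | gen_mul : forall x s, s \in S -> generated S x -> generated S (gmul x s)
  | gen_mulV : forall x s, s \in S -> generated S x -> generated S (gmul x (ginv s)).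

Definition generates (G : grp) (S : seq G) := forall x : G, generated S x.

Local Open Scope ring_scope.

Definition bounded_fun (R : realType) (G : grp) (f : G -> R) :=
  exists M : R, forall x, `|f x| <= M.

Definition left_invariant_mean (R : realType) (G : grp) (m : (G -> R) -> R) :=
  [/\ (forall f h, bounded_fun f -> bounded_fun h ->
         m (fun x => f x + h x) = m f + m h),
      (forall (c : R) f, bounded_fun f -> m (fun x => c * f x) = c * m f),
      (forall f, bounded_fun f -> (forall x, 0 <= f x) -> 0 <= m f),
      m (fun _ => 1) = 1 &
      (forall (g : G) f, bounded_fun f -> m (fun x => f (gmul g x)) = m f)].

Definition amenable (R : realType) (G : grp) :=
  exists m : (G -> R) -> R, left_invariant_mean m.

Definition grp_hom (G : grp) (K : finGroupType) (p : G -> K) :=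
  forall x y, p (gmul x y) = (p x * p y)%g.

Definition twisted_cayley_nadj (K : finGroupType) (T : seq K) (tau : K -> K)
  : 'M[algC]_#|K| :=
  \matrix_(a, b) ((count (fun t => tau (enum_val a * t)%g == enum_val b) T)%:R
                  / (size T)%:R).

(* polynomial whose roots (with multiplicity) are the nontrivial spectrum:
   the characteristic polynomial with one factor (X - 1) removed *)
Definition nontrivial_spectrum_poly (K : finGroupType) (T : seq K) (tau : K -> K)
  : {poly algC} :=
  char_poly (twisted_cayley_nadj T tau) %/ ('X - 1).

Definition gconj (G : grp) (g : G) (x : G) : G := gmul (gmul g x) (ginv g).

(* Main.v *)
(* Write A_i for the operator f |-> avg_s f(sigma(x s)) on G_i: it is symmetric
   because S is stable under s |-> sigma(s^-1).  If its nontrivial spectrum stayed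
   below 1 - c, then for a slightly above 1/2 the operator a(I + A_i) would be
   bounded by r < 1 off the constants, so its k-th power has entries at most
   (2a)^k / |G_i| + r^k.  The orders |G_i| are unbounded, and the same walk on G
   projects onto all the G_i, so its k-th power has entries at most r^k on G.  Its
   Green function u (with a source charging every point) is then finite, positive
   and satisfies A u <= (1/a - 1) u with 1/a - 1 < 1.  A mean on G invariant under
   left and right translations, hence under each x |-> sigma(x s), rules this out. *)
Require Import Defs.
From HB Require Import structures.
From mathcomp Require Import all_boot all_order all_algebra all_fingroup all_field.
From mathcomp Require Import boolp classical_sets reals.
From mathcomp Require Import ring lra.
Import Order.TTheory GRing.Theory Num.Theory.
Local Open Scope ring_scope.

(** * Lazy powers of symmetric stochastic matrices *)

Lemma char_poly_similar (F : fieldType) n (P B : 'M[F]_n) :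
  P \in unitmx -> char_poly (invmx P *m B *m P) = char_poly B.
Proof.
move=> Pu; pose Q := map_mx polyC P.
have Qu : map_mx polyC (invmx P) *m Q = 1%:M.
  by rewrite -map_mxM mulVmx // map_mx1.
rewrite /char_poly /char_poly_mx !map_mxM.
have XE : 'X%:M = map_mx polyC (invmx P) *m 'X%:M *m Q :> 'M[{poly F}]_n.
  by rewrite scalar_mxC -mulmxA Qu mulmx1.
rewrite [in LHS]XE -mulmxBl -mulmxBr !det_mulmx mulrC mulrA -det_mulmx.
by rewrite (mulmx1C Qu) det1 mul1r.
Qed.

Section SymmetricStochastic.
Context {C : numClosedFieldType} {n : nat} (A : 'M[C]_n).
Hypothesis A_ge0 : forall x y, 0 <= A x y.
Hypothesis A_sym : forall x y, A x y = A y x.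
Hypothesis A_row1 : forall x, \sum_y A x y = 1.

Local Notation P := (spectralmx A).
Local Notation d i := (spectral_diag A 0 i).

Let A_herm : A \is hermsymmx.
Proof.
apply: realsym_hermsym.
  apply/is_hermitianmxP; rewrite expr0 scale1r map_mx_id //.
  by apply/matrixP=> x y; rewrite mxE.
by apply/mxOverP=> x y; apply: ger0_real.
Qed.

Let P_unit : P \in unitmx. Proof. exact: spectral_unit. Qed.

Let A_diag : A = invmx P *m diag_mx (spectral_diag A) *m P.
Proof. exact/orthomx_spectralP/hermitian_normalmx. Qed.

Let PPt i j : \sum_x P i x * (P j x)^* = (i == j)%:R.
Proof.
have /unitarymxP/matrixP/(_ i j) := spectral_unitarymx A.
by rewrite !mxE => <-; apply: eq_bigr => x _; rewrite !mxE.
Qed.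

Let PtP x y : \sum_i (P i x)^* * P i y = (x == y)%:R.
Proof.
have /matrixP/(_ x y) := mulVmx P_unit.
rewrite invmx_unitary ?spectral_unitarymx // !mxE => <-.
by apply: eq_bigr => i _; rewrite !mxE.
Qed.

Let P_eigen i y : \sum_x P i x * A x y = d i * P i y.
Proof.
have /matrixP/(_ i y) : P *m A = diag_mx (spectral_diag A) *m P.
  by rewrite [A in P *m A]A_diag !mulmxA mulmxV // mul1mx.
by rewrite mul_diag_mx !mxE.
Qed.

Let d_real i : d i \is Num.real.
Proof. by have /mxOverP := hermitian_spectral_diag_real A_herm; apply. Qed.

(* [2 (1 + d i)] is the Dirichlet form [\sum A x y |P i x + P i y|^2]. *)
Lemma spectral_diag_geN1 i : 0 <= 1 + d i.
Proof.
have e1 : \sum_x \sum_y A x y * (P i x * (P i x)^*) = 1.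
  under eq_bigr => x _ do rewrite -mulr_suml A_row1 mul1r.
  by rewrite PPt eqxx.
have e2 : \sum_x \sum_y A x y * (P i y * (P i y)^*) = 1.
  rewrite exchange_big -[RHS]e1; apply: eq_bigr => y _.
  by apply: eq_bigr => x _; rewrite A_sym.
have e3 : \sum_x \sum_y A x y * (P i x * (P i y)^*) = d i.
  rewrite exchange_big /=.
  under eq_bigr => y _.
    under eq_bigr => x _ do rewrite mulrCA mulrA.
    rewrite -mulr_suml P_eigen -mulrA.
    over.
  by rewrite -mulr_sumr PPt eqxx mulr1.
have e4 : \sum_x \sum_y A x y * (P i y * (P i x)^*) = d i.
  rewrite exchange_big -[RHS]e3; apply: eq_bigr => y _.
  by apply: eq_bigr => x _; rewrite A_sym.
have : 0 <= \sum_x \sum_y A x y * ((P i x + P i y) * (P i x + P i y)^*).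
  by do 2!apply: sumr_ge0 => ? _; rewrite mulr_ge0 // mul_conjC_ge0.
under eq_bigr => x _.
  under eq_bigr => y _ do rewrite rmorphD mulrDl !mulrDr.
  rewrite !big_split /=; over.
rewrite !big_split /= e1 e2 e3 e4 [d i + 1]addrC -mulr2n -mulr_natl.
by rewrite pmulr_rge0.
Qed.

Lemma char_poly_spectral : char_poly A = \prod_i ('X - (d i)%:P).
Proof.
rewrite {1}A_diag char_poly_similar // char_poly_trig ?diag_mx_is_trig //.
by apply: eq_bigr => i _; rewrite mxE eqxx mulr1n.
Qed.

(** The iterate is [(a(I + A))^k]; the rows of [P] form an orthonormal eigenbasis with real
    eigenvalues, in which it acts diagonally. *)
Lemma lazy_power_spectral (a : C) k x y :
  iter k (fun B => a *: (B + A *m B)) 1%:M x y =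
  \sum_i (a * (1 + d i)) ^+ k * ((P i x)^* * P i y).
Proof.
elim: k x y => [|k IH] x y /=.
  by rewrite mxE -PtP; apply: eq_bigr => i _; rewrite expr0 mul1r.
set B := iter k _ _ in IH *.
rewrite !mxE IH; under [X in _ + X]eq_bigr => z _ do rewrite IH mulr_sumr.
rewrite exchange_big -big_split mulr_sumr; apply: eq_bigr => i _ /=.
set r := (a * _) ^+ k.
have -> : \sum_z A x z * (r * ((P i z)^* * P i y)) = r * (d i * ((P i x)^* * P i y)).
  have eig : \sum_z A x z * (P i z)^* = d i * (P i x)^*.
    rewrite -[d i](CrealP (d_real i)) -rmorphM /= -P_eigen rmorph_sum /=.
    by apply: eq_bigr => z _; rewrite rmorphM /= (geC0_conj (A_ge0 _ _)) A_sym mulrC.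
  rewrite [d i * _]mulrA -eig mulr_suml mulr_sumr.
  by apply: eq_bigr => z _; ring.
by rewrite exprS -/r; ring.
Qed.


(* The gap forces the eigenvectors other than the [i0]-th to be orthogonal to the
   constants, so the [i0]-th one is constant of modulus [n^(-1/2)]. *)
Lemma lazy_power_entry_le (a c : C) k x y :
  0 <= a -> 0 < c <= 2 ->
  (forall lam, root (char_poly A %/ ('X - 1)) lam -> 'Re lam <= 1 - c) ->
  `|iter k (fun B => a *: (B + A *m B)) 1%:M x y|
    <= (2 * a) ^+ k / n%:R + (a * (2 - c)) ^+ k.
Proof.
move=> a_ge0 /andP[c_gt0 c_le2] gap.
pose e i := \sum_z P i z.
(* Summing an eigenvector equation over its coordinates, unit row sums force [e i = 0] or
   [d i = 1]. *)
have De i : d i * e i = e i.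
  rewrite mulr_sumr; under eq_bigr => z _ do rewrite -P_eigen.
  rewrite exchange_big /=; apply: eq_bigr => w _.
  by rewrite -mulr_sumr A_row1 mulr1.
(* This expands the constant vector 1 in the eigenbasis, so some [e i] is nonzero. *)
have e_expand z : \sum_i (P i z)^* * e i = 1.
  under eq_bigr => i _ do rewrite mulr_sumr.
  rewrite exchange_big /=; under eq_bigr => w _ do rewrite PtP.
  rewrite (bigD1 z) //= eqxx big1 ?addr0 // => w.
  by rewrite eq_sym => /negbTE->.
have [i0 ei0] : exists i, e i != 0.
  apply/existsP; apply: contraT; rewrite negb_exists => /forallP e0.
  have := e_expand x; rewrite big1 => [/esym/eqP|i _]; first by rewrite oner_eq0.
  by have := e0 i; rewrite negbK => /eqP->; rewrite mulr0.
have di0 : d i0 = 1 by apply: (mulIf ei0); rewrite De mul1r.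
(* Dividing out the factor of [d i0 = 1] leaves every other [d i] as a root of the quotient. *)
have d_gap i : i != i0 -> d i <= 1 - c.
  move=> ne; rewrite -(Creal_ReP _ (d_real i)); apply: gap.
  rewrite char_poly_spectral (bigD1 i0) //= di0 -polyC1 mulKp ?polyXsubC_eq0 //.
  by rewrite (bigD1 i) //= rootM root_XsubC eqxx.
have e_0 i : i != i0 -> e i = 0.
  move=> ne; apply/eqP; apply: contraT => ei.
  have di : d i = 1 by apply: (mulIf ei); rewrite De mul1r.
  have := d_gap i ne; rewrite di lerDl oppr_ge0 => /(lt_le_trans c_gt0).
  by rewrite ltxx.
have P0 z : (P i0 z)^* * e i0 = 1.
  rewrite -(e_expand z) (bigD1 i0) //= big1 ?addr0 // => i ne.
  by rewrite e_0 ?mulr0.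
have nP0 z : `|P i0 z| = `|e i0|^-1.
  apply: (@mulIf _ `|e i0|); first by rewrite normr_eq0.
  by rewrite -norm_conjC -normrM P0 normr1 mulVf // normr_eq0.
have q_n : `|e i0|^-1 * `|e i0|^-1 = n%:R^-1.
  have n_neq0 : n%:R != 0 :> C by rewrite pnatr_eq0; case: (n) x => // -[].
  apply: (mulfI n_neq0); rewrite mulfV //.
  transitivity (\sum_z P i0 z * (P i0 z)^*); last by rewrite PPt eqxx.
  under [RHS]eq_bigr => z _ do rewrite -normCK nP0 expr2.
  by rewrite sumr_const card_ord mulr_natl.
rewrite lazy_power_spectral (bigD1 i0) //=.
apply: le_trans (ler_normD _ _) _; apply: lerD.
  rewrite di0 !normrM norm_conjC !nP0 q_n ger0_norm; last first.
    by rewrite exprn_ge0 // mulr_ge0 // addr_ge0.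
  by rewrite [a * _]mulrC.
apply: le_trans (ler_norm_sum _ _ _) _.
have r_ge0 : 0 <= (a * (2 - c)) ^+ k by rewrite exprn_ge0 // mulr_ge0 // subr_ge0.
have norm1 z : \sum_i `|P i z| ^+ 2 = 1.
  transitivity (\sum_i (P i z)^* * P i z); last by rewrite PtP eqxx.
  by apply: eq_bigr => i _; rewrite normCK mulrC.
(* By AM-GM the product [|P i x| |P i y|] is at most the mean of the squares, and the columns of the
   unitary [P] have norm 1. Adding the [i0] term back only enlarges the bound. *)
apply: (@le_trans _ _ (\sum_i (a * (2 - c)) ^+ k * ((`|P i x| ^+ 2 + `|P i y| ^+ 2) / 2))).
  rewrite [leRHS](bigD1 i0) //= ler_wpDl //.
    by rewrite mulr_ge0 // divr_ge0 // addr_ge0 // exprn_ge0.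
  apply: ler_sum => i ne; rewrite !normrM norm_conjC.
  apply: ler_pM; rewrite ?mulr_ge0 //.
    have l_ge0 : 0 <= a * (1 + d i) by rewrite mulr_ge0 // spectral_diag_geN1.
    rewrite ger0_norm ?exprn_ge0 //; apply: lerXn2r.
    - by rewrite nnegrE.
    - by rewrite nnegrE mulr_ge0 // subr_ge0.
    apply: ler_wpM2l => //.
    by rewrite (_ : 2 - c = 1 + (1 - c)) ?lerD2l ?d_gap //; ring.
  rewrite ler_pdivlMr // -subr_ge0.
  rewrite (_ : _ - _ = (`|P i x| - `|P i y|) ^+ 2); last by ring.
  by rewrite real_exprn_even_ge0 // rpredB // normr_real.
rewrite -mulr_sumr -mulr_suml big_split /= !norm1 (_ : 1 + 1 = 2) //.
by rewrite divff ?mulr1 ?pnatr_eq0.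
Qed.

End SymmetricStochastic.

(** * Quotients and means *)

Section GroupLaws.
Context {G : grp}.
Implicit Types x y z : G.

Lemma gmulKV x y : gmul (ginv x) (gmul x y) = y.
Proof. by rewrite gmulA gmulV gmul1. Qed.

Lemma gmulI x y z : gmul x y = gmul x z -> y = z.
Proof. by move=> e; rewrite -(gmulKV x y) e gmulKV. Qed.

Lemma gmulVr x : gmul x (ginv x) = gone G.
Proof. by apply: (@gmulI (ginv x)); rewrite gmulKV gmulr1. Qed.

Lemma gmulK x y : gmul (gmul x y) (ginv y) = x.
Proof. by rewrite -gmulA gmulVr gmulr1. Qed.

Lemma ginv_unique x y : gmul x y = gone G -> y = ginv x.
Proof. by move=> e; apply: (@gmulI x); rewrite e gmulVr. Qed.

Lemma ginvK x : ginv (ginv x) = x.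
Proof. by apply/esym/ginv_unique; rewrite gmulV. Qed.

Lemma ginvM x y : ginv (gmul x y) = gmul (ginv y) (ginv x).
Proof. by apply/esym/ginv_unique; rewrite gmulA gmulK gmulVr. Qed.

Lemma gconjM g x y : gconj g (gmul x y) = gmul (gconj g x) (gconj g y).
Proof. by rewrite /gconj !gmulA -[gmul (gmul (gmul g x) _) g]gmulA gmulV gmulr1. Qed.

Lemma gconjV g x : gconj g (ginv x) = ginv (gconj g x).
Proof. by rewrite /gconj !ginvM ginvK gmulA. Qed.

Context {K : finGroupType} {p : G -> K} (p_hom : grp_hom p).

Lemma grp_hom1 : p (gone G) = 1%g.
Proof. by apply: (@mulgI _ (p (gone G))); rewrite -p_hom gmulr1 mulg1. Qed.

Lemma grp_homV x : p (ginv x) = (p x)^-1%g.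
Proof. by apply: (@mulgI _ (p x)); rewrite -p_hom gmulVr grp_hom1 mulgV. Qed.

Lemma grp_homJ g x : p (gconj g x) = (p g * p x * (p g)^-1)%g.
Proof. by rewrite /gconj !p_hom grp_homV. Qed.
End GroupLaws.

(* If all orders were at most [N], each quotient would be determined up to
   isomorphism by a labelled Schreier graph on ['I_N.+1], hence two kernels would agree. *)
Lemma finite_quotients_unbounded (G : grp) (Sigma : seq G)
    (K : nat -> finGroupType) (p : forall i, G -> K i) :
  generates Sigma -> (forall i, grp_hom (p i)) ->
  (forall i j, i <> j -> exists x, (p i x == 1%g) != (p j x == 1%g)) ->
  forall N, exists i, (N < #|K i|)%N.
Proof.
move=> gen p_hom p_ker N; apply: contrapT => /forallNP small.
have {}small i : (#|K i| <= N)%N by rewrite leqNgt; apply/negP/small.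
pose code i (k : K i) : 'I_N.+1 := inord (enum_rank k).
pose dec i (q : 'I_N.+1) : K i := nth 1%g (enum (K i)) q.
have codeK i : cancel (code i) (dec i).
  move=> k; rewrite /dec inordK ?nth_enum_rank //.
  by rewrite ltnS; apply/ltnW/(leq_trans (ltn_ord _)).
pose lbl (b : bool) (s : G) := if b then s else ginv s.
pose D : finType := ('I_N.+1 *
  {ffun 'I_(size Sigma) * bool -> {ffun 'I_N.+1 -> 'I_N.+1}})%type.
pose graph i : D := (code i 1%g, [ffun e : 'I_(size Sigma) * bool => [ffun q =>
  code i (dec i q * p i (lbl e.2 (nth (gone G) Sigma e.1)))%g]]).
(* Pigeonhole: [D] is finite and does not depend on [i]. *)
have : ~~ injectiveb (fun i : 'I_#|D|.+1 => graph i).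
  apply/injectiveP => /leq_card; rewrite card_ord; by rewrite ltnn.
case/injectivePn => i [j /eqP ij [e1 /ffunP e2]].
have step b s x : s \in Sigma -> code i (p i x) = code j (p j x) ->
    code i (p i (gmul x (lbl b s))) = code j (p j (gmul x (lbl b s))).
  move=> sS ex; have s_lt : (index s Sigma < size Sigma)%N by rewrite index_mem.
  have /ffunP/(_ (code i (p i x))) := e2 (Ordinal s_lt, b).
  by rewrite !ffunE /= nth_index // {2}ex !codeK -!p_hom.
have same x : code i (p i x) = code j (p j x).
  elim: x / (gen x) => [|x s sS _|x s sS _].
  - by rewrite !grp_hom1.
  - exact: (step true).
  - exact: (step false).
have [|x /negP[]] := p_ker i j; first by move=> /ord_inj.
(* Lying in the kernel means having the label of 1, and both labels agree for [i] and [j]. *)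
rewrite -(inj_eq (can_inj (codeK i))) -(inj_eq (can_inj (codeK j))).
by rewrite same e1.
Qed.

(** * Means invariant under translations on both sides *)

Section BiInvariantMean.
Context {R : realType} {G : grp} (m : (G -> R) -> R).
Hypothesis m_mean : left_invariant_mean m.

Lemma bounded_fun_cst (c : R) : @bounded_fun R G (fun=> c).
Proof. by exists `|c|. Qed.

Lemma bounded_fun_comp (h : G -> G) (f : G -> R) :
  bounded_fun f -> bounded_fun (fun x => f (h x)).
Proof. by move=> [B fB]; exists B. Qed.

Lemma bounded_funD (f h : G -> R) :
  bounded_fun f -> bounded_fun h -> bounded_fun (fun x => f x + h x).
Proof.
move=> [B fB] [B' hB']; exists (B + B') => x.
by apply: le_trans (ler_normD _ _) _; apply: lerD.
Qed.

Lemma bounded_funZ (c : R) (f : G -> R) :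
  bounded_fun f -> bounded_fun (fun x => c * f x).
Proof.
by move=> [B fB]; exists (`|c| * B) => x; rewrite normrM ler_wpM2l.
Qed.

Lemma mean_cst (c : R) : m (fun=> c) = c.
Proof.
have [_ mZ _ m1 _] := m_mean.
rewrite (_ : (fun=> c) = (fun x => c * (fun=> 1) x)); last by apply/funext=> x; rewrite mulr1.
by rewrite mZ ?m1 ?mulr1 //; exact: bounded_fun_cst.
Qed.

Lemma mean_le (f h : G -> R) : bounded_fun f -> bounded_fun h ->
  (forall x, f x <= h x) -> m f <= m h.
Proof.
have [mD mZ m_ge0 _ _] := m_mean => fb hb fh.
have dB : bounded_fun (fun x => h x + -1 * f x).
  by apply: bounded_funD => //; apply: bounded_funZ.
have := m_ge0 _ dB; rewrite mD ?mZ //; last exact: bounded_funZ.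
rewrite mulN1r subr_ge0; apply=> x.
by rewrite mulN1r subr_ge0.
Qed.

Lemma mean_bound (f : G -> R) B : (forall x, `|f x| <= B) -> `|m f| <= B.
Proof.
move=> fB; have fb : bounded_fun f by exists B.
have /(_ _)/andP fB2 x : - B <= f x <= B by rewrite -ler_norml.
rewrite ler_norml -[- B]mean_cst -[B in X in _ && X]mean_cst; apply/andP.
by split; apply: mean_le => //; (try exact: bounded_fun_cst) => x; case: (fB2 x).
Qed.

(** Boundedness is carried through the induction because [m] is additive only on bounded
    functions. *)
Lemma mean_sum (I : Type) (r : seq I) (f : I -> G -> R) :
  (forall i, bounded_fun (f i)) ->
  bounded_fun (fun x => \sum_(i <- r) f i x) /\
  m (fun x => \sum_(i <- r) f i x) = \sum_(i <- r) m (f i).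
Proof.
have [mD _ _ _ _] := m_mean.
move=> fb; elim: r => [|i r [IHb IH]].
  under eq_fun do rewrite big_nil.
  by rewrite big_nil mean_cst; split=> //; exact: bounded_fun_cst.
under eq_fun do rewrite big_cons.
by rewrite big_cons mD // IH; split=> //; exact: bounded_funD.
Qed.

(** Left translations act on the outer variable. A right translation by [h] replaces [y] by
    [h^-1 y], so left invariance of the inner mean absorbs it. *)
Definition bimean (f : G -> R) := m (fun x => m (fun y => f (gmul x (ginv y)))).

Lemma bounded_inner_mean (f : G -> R) : bounded_fun f ->
  bounded_fun (fun x => m (fun y => f (gmul x (ginv y)))).
Proof. by move=> [B fB]; exists B => x; apply: mean_bound. Qed.

Lemma bimean_mean : left_invariant_mean bimean.
Proof.
have [mD mZ m_ge0 m1 mL] := m_mean.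
split=> [f h fb hb|c f fb|f fb f0||g f fb].
- rewrite /bimean -mD; try exact: bounded_inner_mean.
  by congr m; apply/funext=> x; rewrite mD //; apply: bounded_fun_comp.
- rewrite /bimean -mZ; last exact: bounded_inner_mean.
  by congr m; apply/funext=> x; rewrite mZ //; apply: bounded_fun_comp.
- apply: (m_ge0); first exact: bounded_inner_mean.
  by move=> x; apply: m_ge0 => //; apply: bounded_fun_comp.
- by rewrite /bimean !mean_cst.
- rewrite /bimean -[RHS](mL g); last exact: bounded_inner_mean.
  by congr m; apply/funext=> x; congr m; apply/funext=> y; rewrite gmulA.
Qed.

Lemma bimean_rinv (h : G) (f : G -> R) : bounded_fun f ->
  bimean (fun x => f (gmul x h)) = bimean f.
Proof.
have [_ _ _ _ mL] := m_mean => fb.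
rewrite /bimean; congr m; apply/funext=> x.
rewrite -[RHS](mL (ginv h)); last exact: bounded_fun_comp.
by congr m; apply/funext=> y; rewrite ginvM ginvK gmulA.
Qed.

Lemma bimean_linv (h : G) (f : G -> R) : bounded_fun f ->
  bimean (fun x => f (gmul h x)) = bimean f.
Proof. by case: bimean_mean => _ _ _ _; apply. Qed.

End BiInvariantMean.

(* With [t] the ratio of [u] along an edge, [(t - 1/t)/2] is a bounded 1-form
   that changes sign when the edge is reversed, so its mean vanishes; but it is
   at most [t - 1], whose sum over the edges at a vertex is bounded below 0. *)
Lemma amenable_no_superharmonic {R : realType} {G : grp} {g : G} {S : seq G}
    (u : G -> R) (kappa : R) :
  amenable R G -> (forall x, gconj g (gconj g x) = x) ->
  perm_eq (map (fun s => gconj g (ginv s)) S) S -> S != [::] ->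
  (forall x, 0 < u x) -> kappa < 1 ->
  ~ (forall x, \sum_(s <- S) u (gconj g (gmul x s)) <= kappa * (size S)%:R * u x).
Proof.
move=> [m m_mean] gK S_sym S_neq0 u_gt0 kappa_lt1 u_sup.
pose M := bimean m; have M_mean : left_invariant_mean M := bimean_mean _ m_mean.
have [MD MZ _ _ _] := M_mean.
pose nb s x := gconj g (gmul x s).
pose rv s := gconj g (ginv s).
pose t s x := u (nb s x) / u x.
pose psi s x := (t s x - (t s x)^-1) / 2.
(* The label [rv s] reverses the edge labelled [s], which inverts the ratio [t]. *)
have nbK s x : nb (rv s) (nb s x) = x by rewrite /nb gconjM !gK gmulK.
have t_gt0 s x : 0 < t s x by rewrite divr_gt0.
have tV s x : t (rv s) (nb s x) = (t s x)^-1 by rewrite /t nbK invf_div.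
pose B := kappa * (size S)%:R.
have sum_t x : \sum_(s <- S) t s x <= B.
  by rewrite -mulr_suml ler_pdivrMr; [exact: u_sup | exact: u_gt0].
have t_le s x : s \in S -> t s x <= B.
  move=> sS; apply: le_trans (sum_t x); rewrite (big_rem s) //= lerDl.
  by apply: sumr_ge0 => z _; exact: ltW.
have psi_b s : s \in S -> bounded_fun (psi s).
  move=> sS; exists B => x; have h1 := t_le s x sS; have h2 := t_gt0 s x.
  (* The inverse ratio belongs to the reversed edge, whose label is again in [S], so the same bound
     applies. *)
  have : (t s x)^-1 <= B.
    by rewrite -tV t_le // -(perm_mem S_sym) map_f.
  have : 0 < (t s x)^-1 by rewrite invr_gt0.
  rewrite /psi ler_norml; move: ((t s x)^-1) => w h3 h4.
  by apply/andP; split; lra.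
(* The map [x |-> g x s g^-1] is a composite of one left and two right translations. *)
have M_nb s f : bounded_fun f -> M (fun x => f (nb s x)) = M f.
  move=> fb; pose f1 z := f (gmul z (ginv g)); pose f2 z := f1 (gmul g z).
  have f1b : bounded_fun f1 by apply: bounded_fun_comp.
  rewrite -[RHS](bimean_rinv m m_mean (ginv g)) // -[RHS](bimean_linv m m_mean g f1) //.
  by rewrite -[RHS](bimean_rinv m m_mean s f2) //; apply: bounded_fun_comp.
have psi_rv s : s \in S -> M (psi (rv s)) = - M (psi s).
  move=> sS; have rvS : rv s \in S by rewrite -(perm_mem S_sym) map_f.
  rewrite -(M_nb s); last exact: psi_b.
  rewrite -mulN1r -MZ; last exact: psi_b.
  by congr M; apply/funext=> x; rewrite /psi tV invrK; ring.
have sum0 : \sum_(s <- S) M (psi s) = 0.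
  have e : \sum_(s <- S) M (psi s) = - \sum_(s <- S) M (psi s).
    transitivity (\sum_(s <- S) M (psi (rv s))).
      by rewrite -[LHS](perm_big _ S_sym) /= big_map.
    rewrite -sumrN big_seq [RHS]big_seq.
    by apply: eq_bigr => s sS; exact: psi_rv.
  by lra.
(* Extension by zero off [S], as [mean_sum] asks for boundedness at every index. *)
pose phi s x := if s \in S then psi s x else 0.
have phi_b s : bounded_fun (phi s).
  rewrite /phi; case: (s \in S) (psi_b s) => [|_]; first exact.
  exact: bounded_fun_cst.
have [sb sE] := mean_sum M M_mean G S phi phi_b.
have d_gt0 : 0 < (size S)%:R :> R by rewrite ltr0n lt0n size_eq0.
have : M (fun x => \sum_(s <- S) phi s x) <= (kappa - 1) * (size S)%:R.
  rewrite -[leRHS](mean_cst M M_mean); apply: mean_le => //; first exact: bounded_fun_cst.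
  move=> x; apply: (@le_trans _ _ (\sum_(s <- S) (t s x - 1))).
    rewrite big_seq [leRHS]big_seq; apply: ler_sum => s sS.
    rewrite /phi sS /psi -subr_ge0; have tp := t_gt0 s x.
    (* The difference of [t - 1] and [(t - 1/t)/2] is a square over a positive number. *)
    rewrite (_ : _ - _ = (t s x - 1) ^+ 2 / (2 * t s x)).
      by rewrite divr_ge0 ?sqr_ge0 // mulr_ge0 // ltW.
    by field; rewrite gt_eqF.
  rewrite sumrB big_const_seq count_predT iter_addr_0 -[1 *+ _]/((size S)%:R).
  by have := sum_t x; rewrite /B; lra.
rewrite sE (_ : \sum_(s <- S) M (phi s) = 0).
  by rewrite pmulr_lge0 // subr_ge0 leNgt kappa_lt1.
rewrite -[RHS]sum0 big_seq [RHS]big_seq; apply: eq_bigr => s sS.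
by rewrite /phi sS.
Qed.

(** * Twisted Cayley graphs and the lazy walk *)

Section TwistedCayley.
Context {K : finGroupType} (T : seq K) (tau : K -> K).
Local Notation A := (twisted_cayley_nadj T tau).

Lemma twisted_cayley_nadj_ge0 a b : 0 <= A a b.
Proof. by rewrite mxE divr_ge0. Qed.

Lemma twisted_cayley_nadj_sum (a : 'I_#|K|) (f : 'I_#|K| -> algC) :
  \sum_b A a b * f b =
  (size T)%:R^-1 * \sum_(t <- T) f (enum_rank (tau (enum_val a * t)%g)).
Proof.
pose y t := tau (enum_val a * t)%g.
transitivity (\sum_b \sum_(t <- T)
    (size T)%:R^-1 * ((y t == enum_val b)%:R * f b) : algC).
  apply: eq_bigr => b _; rewrite mxE -mulr_sumr -mulr_suml -natr_sum.
  rewrite -sum1_count big_mkcond /=.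
  under eq_bigr => t _ do rewrite -[if _ then _ else _]/(nat_of_bool _).
  by ring.
rewrite exchange_big mulr_sumr /=; apply: eq_bigr => t _.
rewrite -mulr_sumr (bigD1 (enum_rank (y t))) //= enum_rankK eqxx mul1r.
rewrite big1 ?addr0 // => b; rewrite eq_sym -(inj_eq enum_val_inj) enum_rankK.
by move=> /negbTE->; rewrite mul0r.
Qed.

Lemma twisted_cayley_nadj_row1 a : (0 < size T)%N -> \sum_b A a b = 1.
Proof.
move=> T_gt0; under eq_bigr => b _ do rewrite -[A a b]mulr1.
rewrite (twisted_cayley_nadj_sum a (fun=> 1)) big_const_seq count_predT.
by rewrite iter_addr_0 mulVf // pnatr_eq0 -lt0n.
Qed.

(** If [b = tau (a t)], then [tau (b tau(t^-1)) = a]: the edges from [a] to [b] correspond to those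
    from [b] to [a] through the bijection [t |-> tau(t^-1)] of [T]. *)
Lemma twisted_cayley_nadj_sym (h : K) :
  (forall y, tau y = h * y * h^-1)%g -> (forall y, tau (tau y) = y) ->
  perm_eq (map (fun t => tau t^-1)%g T) T ->
  forall a b, A a b = A b a.
Proof.
move=> tauE tauK T_sym a b; rewrite !mxE; congr (_%:R / _).
have tauM y z : tau (y * z)%g = (tau y * tau z)%g by rewrite !tauE !mulgA mulgKV.
rewrite -(seq.permP T_sym) count_map; apply: eq_count => t /=.
rewrite tauM tauK; apply/eqP/eqP => <-; first by rewrite mulgKV tauK.
by rewrite tauK mulgK.
Qed.

End TwistedCayley.

(** * The lazy walk on a possibly infinite graph, and its projections *)

Section LazyWalk.
Context {V : eqType} (nb : V -> seq V) (a : rat).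

(** Entries of [(a(I + A))^k], kept rational so that they can be compared both in [algC], where the
    spectra live, and in [R], where the mean lives. *)
Fixpoint lazy_walk k x y : rat :=
  if k is k'.+1 then
    a * (lazy_walk k' x y + (size (nb x))%:R^-1 * \sum_(z <- nb x) lazy_walk k' z y)
  else (x == y)%:R.

Lemma lazy_walk_ge0 k x y : 0 <= a -> 0 <= lazy_walk k x y.
Proof.
move=> a_ge0; elim: k x => [|k IH] x //=.
by rewrite mulr_ge0 // addr_ge0 // mulr_ge0 // ?invr_ge0 // sumr_ge0.
Qed.

End LazyWalk.

(** The walk projects step by step, and an entry of the quotient also collects the other points of
    the fibre over [p y]. The inequality enters at [k = 0], where [x = y] implies [p x = p y]. *)
Lemma lazy_walk_le_quotient {G : grp} {K : finGroupType} {p : G -> K} (g : G)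
    (S : seq G) (a : rat) k x y :
  grp_hom p -> 0 <= a ->
  ratr (lazy_walk (fun x => map (fun s => gconj g (gmul x s)) S) a k x y) <=
  iter k (fun B => ratr a *: (B + twisted_cayley_nadj (map p S)
    (fun z => p g * z * (p g)^-1)%g *m B)) 1%:M (enum_rank (p x)) (enum_rank (p y)).
Proof.
move=> p_hom a_ge0; elim: k x => [|k IH] x /=.
  rewrite mxE (inj_eq enum_rank_inj) ratr_nat; case: (eqVneq x y) => [->|_].
    by rewrite eqxx.
  exact: ler0n.
set B := iter k _ _ in IH *.
rewrite !mxE twisted_cayley_nadj_sum !size_map !big_map enum_rankK.
rewrite rmorphM rmorphD rmorphM fmorphV /= ratr_nat rmorph_sum /=.
apply: ler_wpM2l; first by rewrite ler0q.
apply: lerD => //; apply: ler_wpM2l; first by rewrite invr_ge0.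
by apply: ler_sum => s _; rewrite -p_hom -grp_homJ.
Qed.

(* The Green function of [lazy_walk] with a weighted source charging every vertex. *)
Section GreenFunction.
Context {R : realType} {V : eqType} (nb : V -> seq V) (a r : rat) (v : nat -> V).
Hypotheses (a_ge0 : 0 <= a) (r_ge0 : 0 <= r) (r_lt1 : r < 1).
Hypothesis walk_le : forall k x y, lazy_walk nb a k x y <= r ^+ k.
Hypothesis v_surj : forall x, exists j, v j = x.

Local Notation p := (lazy_walk nb a).

(** The source gives mass [2^-j] to [v j], which is summable. Cutting time and source at the same
    [N] yields one increasing sequence, whose supremum is the limit. *)
Definition green_partial N x : R :=
  \sum_(k < N) \sum_(j < N) ratr (2^-1 ^+ j * p k x (v j)).

Definition green x : R := sup (range (green_partial^~ x)).

Let term_ge0 k j x : 0 <= ratr (2^-1 ^+ j * p k x (v j)) :> R.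
Proof. by rewrite ler0q mulr_ge0 ?exprn_ge0 ?lazy_walk_ge0. Qed.

Lemma geometric_sum_le (q : rat) N : 0 <= q < 1 -> \sum_(k < N) q ^+ k <= (1 - q)^-1.
Proof.
move=> /andP[q_ge0 q_lt1]; rewrite -div1r ler_pdivlMr ?subr_gt0 //.
have := subrX1 q N; rewrite -opprB -[q - 1]opprB mulNr => /oppr_inj.
by rewrite mulrC => <-; rewrite lerBlDr lerDl exprn_ge0.
Qed.

Lemma green_partial_le N x : green_partial N x <= ratr ((1 - r)^-1 * 2).
Proof.
rewrite /green_partial.
under eq_bigr => k _ do rewrite -rmorph_sum.
rewrite -rmorph_sum ler_rat.
apply: (@le_trans _ _ (\sum_(k < N) \sum_(j < N) r ^+ k * 2^-1 ^+ j)).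
  apply: ler_sum => k _; apply: ler_sum => j _.
  by rewrite mulrC ler_wpM2r // exprn_ge0.
under eq_bigr => k _ do rewrite -mulr_sumr.
rewrite -mulr_suml; apply: ler_pM.
- by apply: sumr_ge0 => k _; exact: exprn_ge0.
- by apply: sumr_ge0 => k _; exact: exprn_ge0.
- by apply: geometric_sum_le; rewrite r_ge0.
- have half : 0 <= (2^-1 : rat) < 1 by lra.
  have := geometric_sum_le 2^-1 N half.
  by rewrite (_ : (1 - 2^-1)^-1 = 2 :> rat) //; field.
Qed.

Lemma green_partial_mono N N' x :
  (N <= N')%N -> green_partial N x <= green_partial N' x.
Proof.
move=> NN'; rewrite /green_partial.
rewrite (big_ord_widen N' (fun k : nat => \sum_(j < N) ratr (2^-1 ^+ j * p k x (v j)) : R)) //.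
rewrite big_mkcond /=; apply: ler_sum => k _.
case: ifP => _; last by rewrite sumr_ge0.
rewrite (big_ord_widen N' (fun j : nat => ratr (2^-1 ^+ j * p k x (v j)) : R)) //.
by rewrite big_mkcond /=; apply: ler_sum => j _; case: ifP.
Qed.

Lemma green_partial_le_green N x : green_partial N x <= green x.
Proof.
apply: ub_le_sup; last by exists N.
by exists (ratr ((1 - r)^-1 * 2)) => _ [M _ <-]; exact: green_partial_le.
Qed.

Lemma green_gt0 x : 0 < green x.
Proof.
(* The cutoff [j.+1] is the first to include source index [j]; its term at time 0 is already
   [2^-j]. *)
have [j <-] := v_surj x; apply: lt_le_trans (green_partial_le_green j.+1 _).
rewrite /green_partial (bigD1 ord0) //= (bigD1 ord_max) //= eqxx mulr1.
apply: ltr_wpDr; first by apply: sumr_ge0 => k _; apply: sumr_ge0.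
apply: ltr_wpDr; first by apply: sumr_ge0 => i _; rewrite ler0q mulr_ge0 ?exprn_ge0 ?ler0n.
by rewrite ltr0q exprn_gt0.
Qed.

(** Partial sums increase with [N], so different cutoffs at different points can be replaced by
    their maximum. *)
Lemma sum_green_le (L : seq V) (b : R) :
  (forall N, \sum_(z <- L) green_partial N z <= b) -> \sum_(z <- L) green z <= b.
Proof.
elim: L b => [|z L IH] b Lb; first by have := Lb 0; rewrite !big_nil.
rewrite big_cons -lerBrDr; apply: ge_sup; first by exists (green_partial 0 z), 0.
move=> _ [N _ <-]; rewrite lerBrDr addrC -lerBrDr; apply: IH => N'.
rewrite lerBrDr addrC; apply: le_trans (Lb (maxn N N')); rewrite big_cons.
by apply: lerD; [|apply: ler_sum => w _]; apply: green_partial_mono; rewrite ?leq_maxl ?leq_maxr.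
Qed.

(** Applying [a(I + A)] shifts time [k] to [k + 1]. The cutoff [N.+1] contains all shifted terms;
    the extra ones, at time 0 or source index [N], are nonnegative. *)
Lemma green_partial_step N x :
  ratr a * (green_partial N x + (size (nb x))%:R^-1 * \sum_(z <- nb x) green_partial N z)
    <= green_partial N.+1 x.
Proof.
rewrite /green_partial big_ord_recl /=.
apply: ler_wpDl; first by apply: sumr_ge0 => j _; exact: (term_ge0 0).
rewrite [X in _^-1 * X]exchange_big /= mulr_sumr -big_split mulr_sumr /=.
apply: ler_sum => k _.
rewrite [X in _^-1 * X]exchange_big /= mulr_sumr -big_split mulr_sumr /=.
rewrite big_ord_recr /=; apply: ler_wpDr; first exact: (term_ge0 k.+1 N x).
apply: ler_sum => j _; rewrite add0n.
rewrite -rmorph_sum -[(size _)%:R](ratr_nat R) -fmorphV -!(rmorphM, rmorphD) /=.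
by rewrite -mulr_sumr ler_rat le_eqVlt; apply/orP; left; apply/eqP; ring.
Qed.

Lemma green_superharmonic x : 0 < a -> nb x != [::] ->
  \sum_(z <- nb x) green z <= (ratr a^-1 - 1) * (size (nb x))%:R * green x.
Proof.
move=> a_gt0 nb0; have d_gt0 : 0 < (size (nb x))%:R :> R by rewrite ltr0n lt0n size_eq0.
have ra_gt0 : 0 < ratr a :> R by rewrite ltr0q.
have sumx (f : V -> R) : \sum_(z <- nseq (size (nb x)) x) f z = (size (nb x))%:R * f x.
  by rewrite big_nseq iter_addr_0 mulr_natl.
(* Writing the multiple of [green x] as a sum over copies of [x] lets [sum_green_le] pass to the
   limit in [a(u + A u) <= u] at once. *)
have : \sum_(z <- nseq (size (nb x)) x ++ nb x) green z
    <= (ratr a)^-1 * (size (nb x))%:R * green x.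
  apply: sum_green_le => N; rewrite big_cat sumx /=.
  have := le_trans (green_partial_step N x) (green_partial_le_green _ _).
  rewrite -ler_pdivlMl // -(ler_pM2l d_gt0) mulrDr mulrA mulfV ?gt_eqF // mul1r.
  by move/le_trans; apply; rewrite mulrCA mulrA.
by rewrite big_cat sumx /= fmorphV; lra.
Qed.

End GreenFunction.

(** * Conclusion *)

Lemma generates_enum {G : grp} {Sigma : seq G} : generates Sigma ->
  exists v : nat -> G, forall x, exists j, v j = x.
Proof.
move=> gen; pose step x (e : nat * bool) :=
  gmul x (let s := nth (gone G) Sigma e.1 in if e.2 then s else ginv s).
(* Signed words in the generators are countable; numbers that code no word are sent to the empty
   word. *)
exists (fun j => foldl step (gone G) (odflt [::] (unpickle j))) => x.
suff [w <-] : exists w, foldl step (gone G) w = x by exists (pickle w); rewrite pickleK.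
elim: x / (gen x) => [|x s sS _ [w <-]|x s sS _ [w <-]].
- by exists [::].
- by exists (rcons w (index s Sigma, true)); rewrite foldl_rcons /step /= nth_index.
- by exists (rcons w (index s Sigma, false)); rewrite foldl_rcons /step /= nth_index.
Qed.

Lemma undup_involution_closed (T : eqType) (f : T -> T) (s : seq T) :
  involutive f -> perm_eq (map f (undup (s ++ map f s))) (undup (s ++ map f s)).
Proof.
move=> fK; have f_inj := inv_inj fK.
have mem_f (r : seq T) x : (x \in map f r) = (f x \in r).
  by rewrite -{1}[x]fK mem_map.
apply: uniq_perm; rewrite ?map_inj_uniq ?undup_uniq // => x.
by rewrite mem_f !mem_undup !mem_cat !mem_f fK orbC.
Qed.

Section UniformGap.
Context {G : grp} (g : G) (S : seq G) (K : nat -> finGroupType).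
Context (p : forall i, G -> K i) (c : algC).
Hypothesis gK : forall x, gconj g (gconj g x) = x.
Hypothesis S_sym : perm_eq (map (fun s => gconj g (ginv s)) S) S.
Hypothesis S_neq0 : S != [::].
Hypothesis p_hom : forall i, grp_hom (p i).
Hypothesis p_surj : forall i (y : K i), exists x, p i x = y.
Hypothesis K_unbounded : forall N, exists i, (N < #|K i|)%N.
Hypothesis c_gt0 : 0 < c.
Hypothesis gap : forall (i : nat) (lam : algC),
  root (nontrivial_spectrum_poly (map (p i) S)
    (fun y : K i => (p i g * y * (p i g)^-1)%g)) lam -> 'Re lam <= 1 - c.

(** The walk on [G] does not depend on [i], so the term [(2a)^k / #|K i|] of the quotient bound can
    be made arbitrarily small. *)
Lemma uniform_gap_lazy_walk_le (a e : rat) : 0 <= a -> 0 < e <= 1 -> ratr e <= c ->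
  forall k x y,
    lazy_walk (fun x => map (fun s => gconj g (gmul x s)) S) a k x y
      <= (a * (2 - e)) ^+ k.
Proof.
move=> a_ge0 /andP[e_gt0 e_le1] e_le_c k x y; rewrite leNgt; apply/negP.
set q := lazy_walk _ _ _ _ _; set r := (_ ^+ k) => lt_rq.
(* Once [#|K i|] exceeds [b], the term [(2a)^k / #|K i|] is smaller than the supposed excess
   [q - r]. *)
pose b := (2 * a) ^+ k / (q - r).
have b_ge0 : 0 <= b by rewrite divr_ge0 ?subr_ge0 ?(ltW lt_rq) // exprn_ge0 // mulr_ge0.
have [i Ki] := K_unbounded (Num.bound b).
have K_gt0 : 0 < #|K i|%:R :> rat by rewrite ltr0n (leq_ltn_trans _ Ki).
have b_lt : b < #|K i|%:R by apply: lt_trans (archi_boundP b_ge0) _; rewrite ltr_nat.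
pose A := twisted_cayley_nadj (map (p i) S) (fun y : K i => (p i g * y * (p i g)^-1)%g).
pose B := iter k (fun B => ratr a *: (B + A *m B)) 1%:M.
have q_le : ratr q <= B (enum_rank (p i x)) (enum_rank (p i y)).
  exact: lazy_walk_le_quotient.
have B_le : `|B (enum_rank (p i x)) (enum_rank (p i y))|
    <= (2 * ratr a) ^+ k / #|K i|%:R + (ratr a * (2 - ratr e)) ^+ k.
  apply: lazy_power_entry_le.
  - exact: twisted_cayley_nadj_ge0.
  - apply: (@twisted_cayley_nadj_sym _ _ _ (p i g)) => // [y'|].
      by have [z <-] := p_surj i y'; rewrite -!grp_homJ // gK.
    rewrite -map_comp.
    rewrite (eq_map (_ : _ =1 p i \o (fun s => gconj g (ginv s)))) => [|s /=].
      by rewrite map_comp perm_map.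
    by rewrite grp_homJ // grp_homV.
  - by move=> z; apply: twisted_cayley_nadj_row1; rewrite size_map lt0n size_eq0.
  - by rewrite ler0q.
  - rewrite ltr0q e_gt0 -[2]/(2%:R) -(ratr_nat algC) ler_rat /=.
    by apply: le_trans e_le1 _.
  - by move=> lam /gap /le_trans; apply; rewrite lerD2l lerN2.
have B_ge0 := le_trans (_ : 0 <= ratr q) q_le.
have : q <= (2 * a) ^+ k / #|K i|%:R + r.
  rewrite -(ler_rat algC); apply: le_trans q_le _.
  rewrite ger0_norm in B_le; last by rewrite B_ge0 // ler0q lazy_walk_ge0.
  apply: le_trans B_le _; rewrite /r.
  by rewrite !(rmorphD, rmorphM, rmorphXn, fmorphV, rmorphN, rmorph1) /= !ratr_nat; exact: lexx.
apply/negP; rewrite -ltNge -ltrBrDr ltr_pdivrMr // [ltRHS]mulrC.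
by rewrite -ltr_pdivrMr // subr_gt0.
Qed.

End UniformGap.

Theorem theorem6p2 (R : realType) (G : grp) (Sigma : seq G) (g : G)
  (K : nat -> finGroupType) (pi : forall i, G -> K i) :
  amenable R G ->
  uniq Sigma -> generates Sigma ->
  (* sigma : x |-> g x g^-1 has order two *)
  (forall x, gconj g (gconj g x) = x) ->
  (exists x, gconj g x != x) ->
  (forall i, grp_hom (pi i)) ->
  (forall i, forall y : K i, exists x, pi i x = y) ->
  (forall i j, i <> j -> exists x, (pi i x == 1%g) != (pi j x == 1%g)) ->
  let S := undup (Sigma ++ map (fun s => gconj g (ginv s)) Sigma) in
  ~ (exists c : algC, 0 < c /\
       forall (i : nat) (lam : algC),
         root (nontrivial_spectrum_poly (map (pi i) S)
                 (fun y : K i => (pi i g * y * (pi i g)^-1)%g)) lam ->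
         'Re lam <= 1 - c).
Proof.
move=> G_amen _ gen gK [z0 z0_ne] p_hom p_surj p_ker S [c [c_gt0 gap]].
have S_sym : perm_eq (map (fun s => gconj g (ginv s)) S) S.
  by apply: undup_involution_closed => s; rewrite !gconjV gK ginvK.
(* If [S] were empty, [G] would be trivial and conjugation by [g] the identity. *)
have S_neq0 : S != [::].
  apply: contraNneq z0_ne => S0.
  have noS s : s \notin Sigma.
    apply: contraT => /negPn sS; suff : s \in S by rewrite S0.
    by rewrite mem_undup mem_cat sS.
  elim: (gen z0) => [|x s sS|x s sS]; [|by have := noS s; rewrite sS..].
  by rewrite /gconj gmulr1 gmulVr.
have K_unb := finite_quotients_unbounded G Sigma K pi gen p_hom p_ker.
have [v v_surj] := generates_enum gen.
(* A rational gap below [c], to match the rational walk. *)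
pose e : rat := (Num.bound c^-1).+1%:R^-1.
have e_gt0 : 0 < e by rewrite invr_gt0 ltr0n.
have e_le1 : e <= 1 by rewrite invf_le1 ?ler1n ?ltr0n.
have e_le_c : ratr e <= c.
  rewrite fmorphV /= ratr_nat -[leRHS]invrK lef_pV2 ?posrE ?invr_gt0 ?ltr0n //.
  apply/ltW/(lt_trans (archi_boundP _)); first by rewrite invr_ge0 ltW.
  by rewrite ltr_nat.
(* Here [a > 1/2] gives [1/a - 1 < 1], while [a(2 - e) = 1 - e/4 - e^2/8 < 1]. *)
pose a : rat := 2^-1 + e / 8.
have a_gt0 : 0 < a by rewrite /a; lra.
pose nb x := map (fun s => gconj g (gmul x s)) S.
have walk_le k x y : lazy_walk nb a k x y <= (a * (2 - e)) ^+ k.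
  apply: (uniform_gap_lazy_walk_le g S K pi c) => //; first exact: ltW.
  by rewrite e_gt0.
have r_ge0 : 0 <= a * (2 - e) by rewrite mulr_ge0 ?(ltW a_gt0) // subr_ge0; lra.
have r_lt1 : a * (2 - e) < 1 by rewrite /a; nra.
pose u := green (R := R) nb a v.
apply: (@amenable_no_superharmonic R G g S u (ratr a^-1 - 1)) => //.
- exact: green_gt0 (ltW a_gt0) r_ge0 r_lt1 walk_le v_surj.
- rewrite ltrBlDr -[1 + 1]/(2%:R) -(ratr_nat R) ltr_rat /=.
  by rewrite -[ltRHS]invrK ltf_pV2 ?posrE // /a; lra.
- move=> x; have := @green_superharmonic R _ nb a _ v (ltW a_gt0) r_ge0 r_lt1 walk_le x a_gt0.
  by rewrite /nb size_map big_map; apply; rewrite -size_eq0 size_map size_eq0.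
Qed.
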